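(* For all positive integers $k$ and $N$ there are infinitely many totally real multiquadratic fields $K$ of degree $2^k$ over $\mathbb{Q}$ such that $m(K)\geq N$, i.e., every universal totally positive definite quadratic form over $\mathcal{O}_K$ has at least $N$ variables.
   Context: A multiquadratic field is a number field of the form $K=\mathbb{Q}(\sqrt{p_1},\dots,\sqrt{p_k})$ with $k\geq 1$ and $p_1,\dots,p_k\in\mathbb{N}$. For a totally real number field $K$ with ring of integers $\mathcal{O}_K$, an element $\alpha\in K$ is totally positive if $\sigma(\alpha)>0$ for every real embedding $\sigma:K\hookrightarrow\mathbb{R}$; $\mathcal{O}_K^+$ denotes the set of totally positive elements of $\mathcal{O}_K$. An $N$-ary quadratic form over $\mathcal{O}_K$ is $Q(x_1,\dots,x_N)=\sum_{1\leq i\leq j\leq N}a_{ij}x_ix_j$ with all $a_{ij}\in\mathcal{O}_K$ (cross coefficients need not be divisible by $2$). $Q$ is totally positive definite if $\sum_{i\leq j}\sigma(a_{ij})x_ix_j$ is a positive definite real quadratic form for every embedding $\sigma$, and $Q$ is universal if for every $\alpha\in\mathcal{O}_K^+$ there exist $x_1,\dots,x_N\in\mathcal{O}_K$ with $Q(x_1,\dots,x_N)=\alpha$. $m(K)$ denotes the minimal number of variables of a universal totally positive definite quadratic form over $\mathcal{O}_K$. *)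

(* Defs.v *)
From mathcomp Require Import all_boot all_order all_algebra.
From mathcomp Require Import all_field.
Set Implicit Arguments. Unset Strict Implicit. Unset Printing Implicit Defensive.
Import Order.TTheory GRing.Theory Num.Theory.
Local Open Scope ring_scope.

(* A "field" is represented by its carrier, a subset of algC. *)
Definition is_subfield (S : algC -> Prop) : Prop :=
  [/\ S 0, S 1,
      (forall x y, S x -> S y -> S (x - y)),
      (forall x y, S x -> S y -> S (x * y)) &
      (forall x, S x -> x != 0 -> S x^-1)].

Definition mqfield (ps : seq nat) : algC -> Prop :=
  fun x => forall S : algC -> Prop, is_subfield S ->
    (forall p, p \in ps -> S (sqrtC p%:R)) -> S x.

Definition field_degree (K : algC -> Prop) (n : nat) : Prop :=
  exists b : 'I_n -> algC, (forall i, K (b i)) /\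
    forall x, K x -> exists! c : 'rV[rat]_n, x = \sum_(i < n) ratr (c 0 i) * b i.

(* field embeddings of K into algC (= C up to the algebraic part) *)
Definition embedding (K : algC -> Prop) (s : algC -> algC) : Prop :=
  [/\ (forall x y, K x -> K y -> s (x + y) = s x + s y),
      (forall x y, K x -> K y -> s (x * y) = s x * s y) & s 1 = 1].

Definition real_embedding (K : algC -> Prop) (s : algC -> algC) : Prop :=
  embedding K s /\ forall x, K x -> s x \is Num.real.

Definition totally_real (K : algC -> Prop) : Prop :=
  forall s, embedding K s -> forall x, K x -> s x \is Num.real.

Definition OK (K : algC -> Prop) (x : algC) : Prop := K x /\ x \in Aint.

Definition totally_positive (K : algC -> Prop) (a : algC) : Prop :=
  forall s, real_embedding K s -> 0 < s a.

Definition qform (n : nat) (a : 'I_n -> 'I_n -> algC) (x : 'I_n -> algC) : algC :=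
  \sum_(i < n) \sum_(j < n | (i <= j)%N) a i j * x i * x j.

Definition form_over (K : algC -> Prop) (n : nat) (a : 'I_n -> 'I_n -> algC) : Prop :=
  forall i j : 'I_n, (i <= j)%N -> OK K (a i j).

Definition totally_pos_def (K : algC -> Prop) (n : nat)
    (a : 'I_n -> 'I_n -> algC) : Prop :=
  forall s, real_embedding K s ->
    forall x : 'I_n -> algC, (forall i, x i \is Num.real) -> (exists i, x i != 0) ->
      0 < qform (fun i j => s (a i j)) x.

Definition universal (K : algC -> Prop) (n : nat) (a : 'I_n -> 'I_n -> algC) : Prop :=
  forall alpha, OK K alpha -> totally_positive K alpha ->
    exists x : 'I_n -> algC, (forall i, OK K (x i)) /\ qform a x = alpha.

Definition m_ge (K : algC -> Prop) (N : nat) : Prop :=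
  forall (n : nat) (a : 'I_n -> 'I_n -> algC),
    form_over K a -> totally_pos_def K a -> universal K a -> (N <= n)%N.

(* Main.v *)
Require Import Defs.
From HB Require Import structures.
From mathcomp Require Import all_boot all_order all_algebra.
From mathcomp Require Import all_field.
From mathcomp Require Import ring zify.
From Stdlib Require Import Classical.
Import Order.TTheory GRing.Theory Num.Theory.
Local Open Scope ring_scope.

(** Let r = sqrt D0 with D0 squarefree and m^2 + 1 = f^2 D0.  The totally positive
    element w = f - m/r pairs integrally with O_K under the trace, and
    w alpha_t = 1 + t/r for the totally positive integers
    alpha_t = (m + f r)(r + t), 0 <= t < r; so all the alpha_t have the same trace
    Tr(w alpha_t) = 2^k, however large D0 is.  If Q is universal, write
    alpha_t = Q(v_t).  By pigeonhole, when D0 is large compared with the number of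
    variables, v_t = v_t' modulo M O_K for some t <> t', where M = 2^(k+2).
    With v_t - v_t' = M u, the parallelogram law gives
    M^2 Tr(w Q(u)) <= 2 Tr(w (alpha_t + alpha_t')) = 2^(k+2) = M,
    whereas Tr(w Q(u)) is a positive integer.  *)

(** * Which square roots lie in a multiquadratic field *)

(** The [p]-adic valuation of a squared numerator is even, that of [n] times a squared denominator
    is odd. *)
Lemma sqr_odd_logn_notin_Crat (n p : nat) (y : algC) :
  odd (logn p n) -> y ^+ 2 = n%:R -> y \notin Crat.
Proof.
move=> odd_n y2; apply/negP => /CratP [q Dy].
have n_gt0 : (0 < n)%N by case: n odd_n {y2} => //; rewrite logn0.
have q2 : q ^+ 2 = n%:R.
  by apply: (fmorph_inj (ratr : rat -> algC)); rewrite rmorphXn /= -Dy y2 ratr_nat.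
have num_den : (`|numq q| ^ 2 = n * `|denq q| ^ 2)%N.
  have /intr_inj /(congr1 absz) : (numq q ^+ 2)%:~R = (n%:Z * denq q ^+ 2)%:~R :> rat.
    by rewrite intrM !rmorphXn /= numqE exprMn q2.
  by rewrite abszX abszM abszX.
have := congr1 (odd \o logn p) num_den; rewrite /= lognX lognM ?lognX.
- by rewrite oddD !oddM /= odd_n.
- exact: n_gt0.
- by rewrite expn_gt0 absz_gt0 denq_neq0.
Qed.

Lemma minPoly_sqrt (F : fieldType) (L : fieldExtType F) (E : {subfield L}) (x : L) :
  x ^+ 2 \in E -> x \notin E -> minPoly E x = 'X^2 - (x ^+ 2)%:P.
Proof.
move=> Ex2 Ex.
have monQ : ('X^2 - (x ^+ 2)%:P : {poly L}) \is monic.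
  exact: monicXnsubC.
apply/eqP; rewrite -eqp_monic ?monic_minPoly //.
have dvd : minPoly E x %| 'X^2 - (x ^+ 2)%:P.
  apply: minPoly_dvdp; first by rewrite rpredB ?rpredX ?polyOverX ?polyOverC.
  by rewrite /root !hornerE subrr.
rewrite -(dvdp_size_eqp dvd) size_minPoly size_XnsubC // eqSS.
have := dvdp_leq (monic_neq0 monQ) dvd.
rewrite size_minPoly size_XnsubC // ltnS leq_eqVlt => /orP[//|].
rewrite ltnS leq_eqVlt adjoin_deg_eq1 (negPf Ex) /= ltnS leqn0.
by [].
Qed.

(** Write [y = a + b * x] over [E]. As [y ^+ 2] lies in [E], so does [2 * a * b * x]; for [x]
    outside [E] this forces [a = 0] or [b = 0]. *)
Lemma sqrt_in_quadratic_ext (F : fieldType) (L : fieldExtType F) (E : {subfield L})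
    (x y : L) :
  2%:R != 0 :> L -> x ^+ 2 \in E -> y ^+ 2 \in E -> y \in <<E; x>>%VS ->
  (y \in E) || (y * x \in E).
Proof.
move=> two0 Ex2 Ey2 Exy.
have [Ex|Ex] := boolP (x \in E).
  by move: Exy; rewrite (Fadjoin_idP Ex) => ->.
have := size_Fadjoin_poly E x y; set p := Fadjoin_poly E x y => szp.
have deg2 : adjoin_degree E x = 2%N.
  by apply: succn_inj; rewrite -size_minPoly minPoly_sqrt // size_XnsubC.
have Ep i : p`_i \in E by apply/polyOverP: i; apply: Fadjoin_polyOver.
have Dy : y = p`_0 + p`_1 * x.
  rewrite -[LHS](Fadjoin_poly_eq Exy) -/p (horner_coef_wide x szp).
  by rewrite deg2 !big_ord_recl big_ord0 /= expr0 mulr1 addr0 expr1.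
set a := p`_0 in Dy; set b := p`_1 in Dy.
have Eab : ((2%:R * a * b) * x) \in E.
  have -> : 2%:R * a * b * x = y ^+ 2 - a ^+ 2 - b ^+ 2 * x ^+ 2.
    by rewrite Dy; ring.
  by apply: rpredB; [apply: rpredB|apply: rpredM] => //; apply: rpredX; apply: Ep.
have [ab0|ab_n0] := eqVneq (2%:R * a * b) 0; last first.
  case/negP: Ex; rewrite -(mulKf ab_n0 x) rpredM // rpredV.
  by rewrite !rpredM ?Ep ?rpredMn ?rpred1.
move/eqP: ab0; rewrite !mulf_eq0 (negPf two0) /= => /orP[]/eqP z0.
  by rewrite Dy z0 add0r -mulrA -expr2 orbC rpredM // Ep.
by rewrite Dy z0 mul0r addr0 Ep.
Qed.

(** Kummer theory in exponent 2, by descent through the tower: each step removes one generator, at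
    the cost of possibly multiplying [y] by it. *)
Lemma sqrt_in_multiquadratic_ext (F : fieldType) (L : fieldExtType F)
    (E : {subfield L}) (xs : seq L) (y : L) :
  2%:R != 0 :> L -> {in xs, forall x, x ^+ 2 \in E} -> y ^+ 2 \in E ->
  y \in <<E & xs>>%VS -> exists m : bitseq, y * \prod_(x <- mask m xs) x \in E.
Proof.
move=> two0; elim: xs E => [|x xs IH] E Exs Ey2.
  by rewrite adjoin_nil subfield_closed => Ey; exists [::]; rewrite big_nil mulr1.
have sub := subvP_adjoin x.
have Ex2 : x ^+ 2 \in E by rewrite Exs ?mem_head.
rewrite adjoin_cons => /(IH <<E; x>>%AS) [].
- by move=> z xs_z; rewrite sub // Exs // inE xs_z orbT.
- exact: sub.
move=> m Em.
have Em2 : (y * \prod_(x <- mask m xs) x) ^+ 2 \in E.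
  rewrite exprMn -prodrXl rpredM ?sub // big_seq rpred_prod // => z /mem_mask xs_z.
  by rewrite Exs // inE xs_z orbT.
have /orP[Ez|Ez] := sqrt_in_quadratic_ext _ _ _ _ _ two0 Ex2 Em2 Em.
  by exists (false :: m).
by exists (true :: m); rewrite /= big_cons mulrCA mulrC.
Qed.

Lemma in1v_Crat (Qs : fieldExtType rat) (QsC : {rmorphism Qs -> algC}) (x : Qs) :
  x \in 1%VS -> QsC x \in Crat.
Proof.
by case/vlineP => a ->; rewrite rmorphZ_num rmorph1 mulr1; apply/CratP; exists a.
Qed.

Lemma sqrt_nat_in1v (Qs : fieldExtType rat) (QsC : {rmorphism Qs -> algC})
    (x : Qs) (d : nat) :
  QsC x = sqrtC d%:R -> x ^+ 2 \in 1%VS.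
Proof.
move=> Dx; have -> : x ^+ 2 = d%:R.
  by apply: (fmorph_inj QsC); rewrite rmorphXn /= Dx sqrtCK rmorph_nat.
exact: (rpred_nat (1%AS : {subfield Qs}) d).
Qed.

(** Otherwise [y] times a subproduct of [zs] would be rational, but the square of that number is [D]
    times a product of elements of [ds], whose valuation at [p] is odd. *)
Lemma sqrt_notin_adjoin (Qs : fieldExtType rat) (QsC : {rmorphism Qs -> algC})
    (zs : seq Qs) (y : Qs) (ds : seq nat) (D p : nat) :
  map QsC zs = [seq sqrtC d%:R | d <- ds] -> QsC y = sqrtC D%:R ->
  odd (logn p D) -> {in ds, forall d, (0 < d)%N && ~~ odd (logn p d)} ->
  y \notin <<1 & zs>>%VS.
Proof.
move=> Dzs Dy odd_n evds; apply/negP => yin.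
have sq_zs : {in zs, forall z, z ^+ 2 \in 1%VS}.
  move=> z zs_z; have : QsC z \in map QsC zs by rewrite map_f.
  by rewrite Dzs => /mapP[d _ Dz]; apply: sqrt_nat_in1v Dz.
have two0 : 2%:R != 0 :> Qs by rewrite -(fmorph_eq0 QsC) rmorph_nat pnatr_eq0.
have [m] := @sqrt_in_multiquadratic_ext _ _ 1%AS _ _ two0 sq_zs (sqrt_nat_in1v _ _ _ _ Dy) yin.
move/(in1v_Crat Qs QsC); apply/negP.
apply: (@sqr_odd_logn_notin_Crat (D * \prod_(d <- mask m ds) d) p).
  have radicand_gt0 : (0 < D)%N by case: (D) odd_n => //; rewrite logn0.
  have : all [pred d | (0 < d)%N && ~~ odd (logn p d)] (mask m ds).
    by apply/allP => d /mem_mask/evds.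
  suff aux s : all [pred d | (0 < d)%N && ~~ odd (logn p d)] s ->
     (0 < \prod_(d <- s) d)%N && ~~ odd (logn p (\prod_(d <- s) d)).
    by move=> /aux/andP[pos ev]; rewrite lognM // oddD odd_n (negPf ev).
  elim: s => [|d s IH] /=; first by rewrite big_nil logn1.
  case/andP=> /andP[d0 de] /IH/andP[s0 se].
  by rewrite big_cons muln_gt0 d0 s0 lognM // oddD (negPf de) (negPf se).
rewrite rmorphM exprMn /= Dy sqrtCK natrM; congr (_ * _).
rewrite rmorph_prod -prodrXl natr_prod.
rewrite -(big_map QsC xpredT (fun z => z ^+ 2)) map_mask Dzs -map_mask big_map.
by apply: eq_bigr => d _; rewrite sqrtCK.
Qed.

(** The image of [<<1 & zs>>] in [algC] is a subfield containing the generators, so it contains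
    [mqfield ds]. *)
Lemma sqrtC_notin_mqfield (ds : seq nat) (D p : nat) :
  odd (logn p D) -> {in ds, forall d, (0 < d)%N && ~~ odd (logn p d)} ->
  ~ mqfield ds (sqrtC D%:R).
Proof.
move=> odd_n evds inK.
have [Qs [QsC [[//|y zs] [Dy Dzs] _]]] :=
  num_field_exists (sqrtC D%:R :: [seq sqrtC d%:R | d <- ds]).
have /negP[] := sqrt_notin_adjoin Qs QsC zs y ds D p Dzs Dy odd_n evds.
have [|p1 p1_ds|z zin Dz] := inK (fun x => exists2 z, z \in <<1 & zs>>%VS & QsC z = x).
- split.
  + by exists 0; rewrite ?rmorph0 ?mem0v.
  + by exists 1; rewrite ?rmorph1 // (rpred1 <<1 & zs>>%AS).
  + by move=> _ _ [u uE <-] [v vE <-]; exists (u - v); rewrite ?rmorphB // (rpredB uE vE).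
  + by move=> _ _ [u uE <-] [v vE <-]; exists (u * v); rewrite ?rmorphM // (@rpredM _ <<1 & zs>>%AS).
  + move=> _ [u uE <-] _; exists u^-1; last by rewrite fmorphV.
    by rewrite (@rpredVr _ <<1 & zs>>%AS).
- have : sqrtC p1%:R \in map QsC zs by rewrite Dzs; apply: (map_f (fun d : nat => sqrtC d%:R)).

  by case/mapP=> z zs_z ->; exists z; rewrite ?seqv_sub_adjoin.
by rewrite -(fmorph_inj QsC (etrans Dz (esym Dy))).
Qed.

(** * Automorphisms with prescribed signs on square roots *)

(** Adjoin one root [z] at a time. Being outside the field built so far, [z] has minimal polynomial
    ['X^2 - z^2], with coefficients fixed by [f], so [f] extends with either sign. *)
Lemma signed_kHom (F : fieldType) (L : fieldExtType F) (zs : seq L) (eps : nat -> bool) :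
  {in zs, forall z, z ^+ 2 \in 1%VS} ->
  (forall i, (i < size zs)%N -> zs`_i \notin <<1 & take i zs>>%VS) ->
  exists2 f : 'End(L), kHom 1 <<1 & zs>> f &
    forall i, (i < size zs)%N -> f zs`_i = (-1) ^+ eps i * zs`_i.
Proof.
elim/last_ind: zs => [|zs z IH] sq_zs indep.
  by exists \1%VF => //; apply: kHom1.
have [||f homf Df] := IH.
- by move=> x xzs; rewrite sq_zs // mem_rcons inE xzs orbT.
- move=> i lti; have := indep i; rewrite size_rcons ltnW // => /(_ isT).
  by rewrite nth_rcons lti -cats1 takel_cat // ltnW.
have z2 : z ^+ 2 \in 1%VS by rewrite sq_zs // mem_rcons mem_head.
have Ez : z \notin <<1 & zs>>%VS.
  have := indep (size zs); rewrite size_rcons leqnn => /(_ isT).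
  by rewrite nth_rcons ltnn eqxx -cats1 take_size_cat.
pose E := <<1 & zs>>%AS.
have sub1E : (1%VS <= E)%VS by apply: sub1v.
have minP : minPoly E z = 'X^2 - (z ^+ 2)%:P.
  by apply: minPoly_sqrt => //; apply: (subvP sub1E).
have minP1 : minPoly E z \is a polyOver (1%AS : {subfield L}).
  by rewrite minP rpredB ?rpredX ?polyOverX ?polyOverC.
have fP : map_poly f (minPoly E z) = minPoly E z by apply: kHom_poly_id homf minP1.
pose y := (-1) ^+ eps (size zs) * z.
have rooty : root (map_poly f (minPoly E z)) y.
  by rewrite fP minP /root !hornerE exprMn sqrr_sign mul1r subrr.
exists (kHomExtend E f z y).
  by rewrite adjoin_rcons; apply: (kHomExtendP (K := 1%AS) (E := E)).
move=> i; rewrite size_rcons ltnS leq_eqVlt nth_rcons => /orP[/eqP->|lti].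
  by rewrite ltnn eqxx (kHomExtend_val homf).
rewrite lti kHomExtend_id ?Df //.
by rewrite seqv_sub_adjoin // mem_nth.
Qed.

(** The valuation condition makes each square root independent of the earlier ones. The map is built
    on a number field and then extended to [algC]. *)
Lemma signed_automorphism (ds : seq nat) (eps : nat -> bool) :
  (forall i, (i < size ds)%N -> exists p, odd (logn p (nth 0%N ds i)) /\
     {in take i ds, forall d, (0 < d)%N && ~~ odd (logn p d)}) ->
  exists nu : {rmorphism algC -> algC}, forall i, (i < size ds)%N ->
    nu (sqrtC (nth 0%N ds i)%:R) = (-1) ^+ eps i * sqrtC (nth 0%N ds i)%:R.
Proof.
move=> indep.
have [Qs [QsC [zs Dzs genQs]]] := num_field_exists [seq sqrtC d%:R | d <- ds].
have szs : size zs = size ds by rewrite -(size_map QsC) Dzs size_map.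
have Dz i : (i < size ds)%N -> QsC zs`_i = sqrtC (nth 0%N ds i)%:R.
  by move=> lti; rewrite -(nth_map 0 0) ?szs // Dzs (nth_map 0%N).
have [||f homf Df] := signed_kHom rat Qs zs eps.
- move=> z /(nthP 0)[i lti <-]; rewrite szs in lti.
  exact: sqrt_nat_in1v (Dz i lti).
- move=> i; rewrite szs => lti; have [p [oddp evp]] := indep i lti.
  apply: sqrt_notin_adjoin (Dz i lti) oddp evp.
  by rewrite !map_take Dzs.
rewrite genQs in homf.
have fM : monoid_morphism f by apply/kHom_monoid_morphism.
pose fMm := GRing.isMonoidMorphism.Build _ _ (fun_of_lfun f) fM.
pose fRM : {rmorphism _ -> _} := HB.pack (fun_of_lfun f) fMm.
have [nu Dnu] := extend_algC_subfield_aut QsC fRM.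
exists nu => i lti; rewrite -Dz // -Dnu /= Df ?szs //.
by rewrite rmorphM rmorphXn rmorphN1.
Qed.

(** * Subfields of [algC] and their embeddings *)

Section SubfieldTheory.
Variables (S : algC -> Prop) (fS : is_subfield S).

Lemma subfieldN x : S x -> S (- x).
Proof. by case: fS => S0 _ SB _ _ Sx; rewrite -sub0r; apply: SB. Qed.

Lemma subfieldD x y : S x -> S y -> S (x + y).
Proof. by case: fS => _ _ SB _ _ Sx Sy; rewrite -[y]opprK; apply/SB/subfieldN. Qed.

Lemma subfieldB x y : S x -> S y -> S (x - y).
Proof. by case: fS => _ _ SB _ _; apply: SB. Qed.

Lemma subfield_nat n : S n%:R.
Proof.
case: fS => S0 S1 _ _ _; elim: n => [|n IH] //.
by rewrite -addn1 natrD; apply: subfieldD.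
Qed.

Lemma subfield_int (z : int) : S z%:~R.
Proof.
by case: z => n; rewrite ?NegzE ?rmorphN; [|apply: subfieldN]; apply: subfield_nat.
Qed.

Lemma subfieldV x : S x -> S x^-1.
Proof.
case: fS => S0 _ _ _ SV Sx; have [->|x0] := eqVneq x 0; first by rewrite invr0.
exact: SV.
Qed.

Lemma subfieldM x y : S x -> S y -> S (x * y).
Proof. by case: fS => _ _ _ SM _; apply: SM. Qed.

Lemma subfield_rat (q : rat) : S (ratr q).
Proof. by apply: subfieldM; [|apply: subfieldV]; apply: subfield_int. Qed.

Lemma subfield_sum (I : Type) (r : seq I) (P : pred I) (F : I -> algC) :
  (forall i, P i -> S (F i)) -> S (\sum_(i <- r | P i) F i).
Proof.
by move=> SF; apply: (big_ind S) => //; [case: fS | apply: subfieldD].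
Qed.

Lemma subfield_prod (I : Type) (r : seq I) (P : pred I) (F : I -> algC) :
  (forall i, P i -> S (F i)) -> S (\prod_(i <- r | P i) F i).
Proof.
by move=> SF; apply: (big_ind S) => //; [case: fS | apply: subfieldM].
Qed.

Section Embedding.
Variables (s : algC -> algC) (es : embedding S s).

Lemma embeddingD x y : S x -> S y -> s (x + y) = s x + s y.
Proof. by case: es => sD _ _; apply: sD. Qed.

Lemma embeddingM x y : S x -> S y -> s (x * y) = s x * s y.
Proof. by case: es => _ sM _; apply: sM. Qed.

Lemma embedding0 : s 0 = 0.
Proof.
have [S0 _ _ _ _] := fS.
by apply: (addIr (s 0)); rewrite -embeddingD // !add0r.
Qed.

Lemma embedding_nat n : s n%:R = n%:R.
Proof.
have [_ S1 _ _ _] := fS; have [_ _ s1] := es.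
elim: n => [|n IH]; first exact: embedding0.
rewrite -addn1 natrD embeddingD ?IH ?s1 //; exact: subfield_nat.
Qed.

Lemma embeddingB x y : S x -> S y -> s (x - y) = s x - s y.
Proof.
move=> Sx Sy; apply: (addIr (s y)); rewrite -embeddingD //.
  by rewrite !subrK.
by case: fS => _ _ SB _ _; apply: SB.
Qed.

Lemma embeddingV x : S x -> s x^-1 = (s x)^-1.
Proof.
move=> Sx; have [->|x0] := eqVneq x 0; first by rewrite invr0 embedding0 invr0.
have [_ _ s1] := es.
have sxV : s x * s x^-1 = 1 by rewrite -embeddingM ?divff //; apply: subfieldV.
have sx0 : s x != 0.
  by apply/eqP => sx0; move/eqP: sxV; rewrite sx0 mul0r eq_sym oner_eq0.
by apply: (mulfI sx0); rewrite sxV divff.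
Qed.

End Embedding.
End SubfieldTheory.

(** * Multiquadratic fields and their embeddings *)

Lemma mqfield_subfield (ps : seq nat) : is_subfield (mqfield ps).
Proof.
split=> [|||x y Kx Ky|x Kx x0] => [S fS _|S fS _|x y Kx Ky S fS Sps|S fS Sps|S fS Sps].
- by case: fS.
- by case: fS.
- by case: (fS) => _ _ SB _ _; apply: SB; [apply: Kx | apply: Ky].
- by apply: subfieldM => //; [apply: Kx | apply: Ky].
- by apply: subfieldV => //; apply: Kx.
Qed.

Lemma mqfield_sqrtC (ps : seq nat) (p : nat) : p \in ps -> mqfield ps (sqrtC p%:R).
Proof. by move=> ps_p S _; apply. Qed.

Lemma embedding_sqrtC (ps : seq nat) (s : algC -> algC) (p : nat) :
  embedding (mqfield ps) s -> p \in ps ->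
  s (sqrtC p%:R) = sqrtC p%:R \/ s (sqrtC p%:R) = - sqrtC p%:R.
Proof.
move=> es ps_p; have fK := mqfield_subfield ps.
have /eqP : s (sqrtC p%:R) ^+ 2 = sqrtC p%:R ^+ 2.
  rewrite expr2 -(embeddingM _ _ es) -?expr2 ?sqrtCK ?(embedding_nat _ fK _ es) //.
    exact: mqfield_sqrtC.
  exact: mqfield_sqrtC.
by rewrite eqf_sqr => /orP[] /eqP; [left | right].
Qed.

(** Each generator goes to plus or minus itself, which is real, and the elements with real image
    form a subfield. Membership in the field is carried along because [s] is a homomorphism only
    there. *)
Lemma mqfield_totally_real (ps : seq nat) : totally_real (mqfield ps).
Proof.
move=> s es x Kx; have fK := mqfield_subfield ps.
have [] // : mqfield ps x /\ s x \is Num.real.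
apply: (Kx (fun x => mqfield ps x /\ s x \is Num.real)) => [|p ps_p].
  split=> [|||y z [Ky ry] [Kz rz]|y [Ky ry] _] => [||y z [Ky ry] [Kz rz]||].
  - by rewrite (embedding0 _ fK _ es) rpred0; case: fK.
  - by case: es => _ _ ->; rewrite rpred1; case: fK.
  - by rewrite (embeddingB _ fK _ es) // rpredB //; split=> //; exact: (subfieldB _ fK).
  - by rewrite (embeddingM _ _ es) // rpredM //; split=> //; exact: (subfieldM _ fK).
  - by rewrite (embeddingV _ fK _ es) // rpredV; split=> //; exact: (subfieldV _ fK).
split; first exact: mqfield_sqrtC.
have sq_real : sqrtC p%:R \is @Num.real algC by rewrite ger0_real // sqrtC_ge0 ler0n.
by have [->|->] := embedding_sqrtC _ _ _ es ps_p; rewrite ?rpredN.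
Qed.

Lemma rat_subalgebra_invr (S : algC -> Prop) :
  (forall q : rat, S (ratr q)) -> (forall x y, S x -> S y -> S (x + y)) ->
  (forall x y, S x -> S y -> S (x * y)) -> forall x, S x -> S x^-1.
Proof.
(* An equation q(x) x + p_0 = 0 with p_0 != 0 exhibits x^-1 as a polynomial in x. *)
move=> Sq SD SM x Sx; have S0 : S 0 by have := Sq 0; rewrite rmorph0.
have [->|x0] := eqVneq x 0; first by rewrite invr0.
have Shorner (q : {poly rat}) : S (map_poly ratr q).[x].
  elim/poly_ind: q => [|q c IH]; first by rewrite rmorph0 horner0.
  rewrite rmorphD rmorphM /= map_polyX map_polyC !hornerE /=.
  by apply: SD; [apply: SM | apply: Sq].
have [p [_ monp dvdp]] := minCpolyP x.
have root_px : root (map_poly ratr p) x by rewrite dvdp.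
(* By minimality: if [p = q * 'X], then [q], of smaller degree, already vanishes at [x != 0]. *)
have p0 : p`_0 != 0.
  apply: contraNneq x0 => p0.
  have : root p 0 by rewrite /root horner_coef0 p0.
  case/factor_theorem => q; rewrite subr0 => Dp.
  have q_n0 : q != 0.
    by apply: contraTneq monp => q0; rewrite Dp q0 mul0r monicE lead_coef0 eq_sym oner_eq0.
  move: (root_px); rewrite Dp rmorphM /= map_polyX rootM => /orP[|].
    rewrite dvdp => /(dvdp_leq q_n0).
    by rewrite Dp size_mulX // ltnn.
  by rewrite /root hornerX.
pose q := (p - (p`_0)%:P) %/ 'X.
have Dp : p = q * 'X + (p`_0)%:P.
  rewrite divpK ?subrK // -['X]subr0 -polyC0 dvdp_XsubCl /root !hornerE horner_coef0.
  by rewrite subrr.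
have : (map_poly ratr q).[x] * x + ratr p`_0 = 0 :> algC.
  move/eqP: root_px; rewrite Dp rmorphD rmorphM /= map_polyX map_polyC !hornerE /=.
  by rewrite -Dp.
move/eqP; rewrite addr_eq0 => /eqP qx.
have -> : x^-1 = (map_poly ratr q).[x] * ratr (- (p`_0)^-1).
  apply: (mulIf x0); rewrite mulVf // mulrAC qx mulNr rmorphN fmorphV mulrN opprK.
  by rewrite divff // fmorph_eq0.
exact: SM.
Qed.

(** * Quadratic forms and their integral values *)

Section QuadraticForms.
Variables (n : nat) (a : 'I_n -> 'I_n -> algC).
Implicit Types x y : 'I_n -> algC.

Lemma qform_rmorphism (s : {rmorphism algC -> algC}) x :
  s (qform a x) = qform (fun i j => s (a i j)) (fun i => s (x i)).
Proof.
rewrite /qform rmorph_sum; apply: eq_bigr => i _; rewrite rmorph_sum.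
by apply: eq_bigr => j _; rewrite !rmorphM.
Qed.

Lemma qformZ c x : qform a (fun i => c * x i) = c ^+ 2 * qform a x.
Proof.
rewrite /qform mulr_sumr; apply: eq_bigr => i _; rewrite mulr_sumr.
by apply: eq_bigr => j _; ring.
Qed.

Lemma qform0 x : (forall i, x i = 0) -> qform a x = 0.
Proof. by move=> x0; rewrite /qform big1 // => i _; rewrite big1 // => j _; rewrite x0 mulr0 mul0r. Qed.

Lemma eq_qform x y : x =1 y -> qform a x = qform a y.
Proof. by move=> xy; apply: eq_bigr => i _; apply: eq_bigr => j _; rewrite !xy. Qed.

Lemma qform_parallelogram x y :
  qform a (fun i => x i + y i) + qform a (fun i => x i - y i) =
  2%:R * (qform a x + qform a y).
Proof.
rewrite /qform -!big_split mulr_sumr; apply: eq_bigr => i _ /=.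
rewrite -!big_split mulr_sumr; apply: eq_bigr => j _ /=; ring.
Qed.

End QuadraticForms.

Section RingOfIntegers.
Variables (K : algC -> Prop) (fK : is_subfield K).

Lemma OK_nat n : OK K n%:R.
Proof. by split; [apply: subfield_nat | rewrite rpred_nat]. Qed.

Lemma OKD x y : OK K x -> OK K y -> OK K (x + y).
Proof. by move=> [Kx Ax] [Ky Ay]; split; [apply: subfieldD | rewrite rpredD]. Qed.

Lemma OKM x y : OK K x -> OK K y -> OK K (x * y).
Proof. by move=> [Kx Ax] [Ky Ay]; split; [apply: subfieldM | rewrite rpredM]. Qed.

Lemma OK_qform n (a : 'I_n -> 'I_n -> algC) (x : 'I_n -> algC) :
  form_over K a -> (forall i, OK K (x i)) -> OK K (qform a x).
Proof.
move=> aK xK; have sumK I (s : seq I) (P : pred I) (F : I -> algC) :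
    (forall i, P i -> OK K (F i)) -> OK K (\sum_(i <- s | P i) F i).
  by move=> FK; apply: (big_ind (OK K)) => //; [apply: (OK_nat 0) | apply: OKD].
apply: (sumK) => i _; apply: (sumK) => j le_ij.
by apply: OKM => //; apply: OKM => //; apply: aK.
Qed.

End RingOfIntegers.

(** * The basis of square roots, sign automorphisms and characters *)

Lemma card_set_ord (k : nat) : #|{: {set 'I_k}}| = (2 ^ k)%N.
Proof.
by rewrite -cardsT -powersetT card_powerset cardsT card_ord.
Qed.

(** A prime dividing the denominator is coprime to the numerator, so its square would divide [n]. *)
Lemma sqfree_sqr_rat_int (n : nat) (q : rat) (m : int) :
  (0 < n)%N -> (forall p, (logn p n <= 1)%N) -> q ^+ 2 * n%:R = m%:~R ->
  q = (numq q)%:~R.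
Proof.
move=> n_gt0 sqfree_n q2n.
have /intr_inj /(congr1 absz) :
    (numq q ^+ 2 * n%:Z)%:~R = (m * denq q ^+ 2)%:~R :> rat.
  by rewrite intrM rmorphXn [RHS]intrM rmorphXn /= numqE exprMn mulrAC q2n.
rewrite abszM abszX [RHS]abszM abszX absz_nat => num_den.
have [den1|den_n1] := eqVneq `|denq q|%N 1%N.
  by rewrite numqE -(gez0_abs (denq_ge0 q)) den1 mulr1.
have p_pr : prime (pdiv `|denq q|) by rewrite pdiv_prime // ltn_neqAle eq_sym den_n1 absz_gt0 denq_neq0.
have := sqfree_n (pdiv `|denq q|); rewrite leqNgt -pfactor_dvdn // => /negP[].
rewrite -(@Gauss_dvdr _ (`|numq q| ^ 2)).
  by rewrite num_den dvdn_mull // dvdn_exp2r // pdiv_dvd.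
rewrite coprimeXl // coprimeXr // coprime_sym.
exact: coprime_dvdr (pdiv_dvd _) (coprime_num_den q).
Qed.

Section Multiquadratic.
Variables (k : nat) (D : 'I_k -> nat).
Hypothesis D_gt1 : forall i, (1 < D i)%N.
Hypothesis D_sqfree : forall p, (logn p (\prod_i D i) <= 1)%N.

Let ps : seq nat := [seq D i | i <- enum 'I_k].
Let K := mqfield ps.
Let r (i : 'I_k) : algC := sqrtC (D i)%:R.

(** As [A] varies, these form the standard rational basis of [K]. *)
Definition sqrt_monomial (A : {set 'I_k}) : algC := \prod_(i in A) sqrtC (D i)%:R.
Local Notation b := sqrt_monomial.

(** The characters of the elementary abelian 2-group of subsets: the sign by which the automorphism
    flipping the roots indexed by [A] acts on [sqrt_monomial S]. *)
Definition sign_char (A S : {set 'I_k}) : algC := \prod_(i in S) (-1) ^+ (i \in A).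
Local Notation chi := sign_char.

Lemma radicand_gt0 i : (0 < D i)%N.
Proof. exact: ltnW (D_gt1 i). Qed.

Lemma prod_D_gt0 (P : pred 'I_k) : (0 < \prod_(i | P i) D i)%N.
Proof. by rewrite prodn_gt0 // => i; apply: radicand_gt0. Qed.

Lemma logn_subprod_le1 p (P : pred 'I_k) : (logn p (\prod_(i | P i) D i) <= 1)%N.
Proof.
apply: leq_trans (D_sqfree p); rewrite (bigID P predT) /=.
by rewrite lognM ?prod_D_gt0 // leq_addr.
Qed.

(** As the whole product is squarefree, the least prime factor of [D i] divides [D i] exactly once
    and no other [D j]; this is the independence that [signed_automorphism] requires. *)
Lemma exists_sign_automorphism :
  exists nu : {set 'I_k} -> {rmorphism algC -> algC},
    forall A i, nu A (r i) = (-1) ^+ (i \in A) * r i.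
Proof.
suff ex_nu (A : {set 'I_k}) : exists f : {rmorphism algC -> algC},
    forall i, f (r i) = (-1) ^+ (i \in A) * r i.
  by have [nu nu_r] := fin_all_exists ex_nu; exists nu.
have szps : size ps = k by rewrite size_map size_enum_ord.
have nthps (i : 'I_k) : nth 0%N ps i = D i.
  by rewrite (nth_map i) ?size_enum_ord // nth_ord_enum.
pose eps j := if insub j is Some i then i \in A else false.
have [|nu Dnu] := signed_automorphism ps eps.
  rewrite szps => j ltjk; pose i := Ordinal ltjk.
  have -> : nth 0%N ps j = D i by rewrite -nthps.
  have logi : logn (pdiv (D i)) (D i) = 1%N.
    apply/eqP; rewrite eqn_leq logn_gt0 mem_primes pdiv_prime // pdiv_dvd radicand_gt0 !andbT.
    by have := logn_subprod_le1 (pdiv (D i)) (fun j => j == i); rewrite big_pred1_eq.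
  exists (pdiv (D i)); split; first by rewrite logi.
  move=> d /(nthP 0%N)[l]; rewrite size_takel ?szps ?(ltnW ltjk) // => ltlj.
  rewrite nth_take //; pose i' := Ordinal (ltn_trans ltlj ltjk).
  have -> : nth 0%N ps l = D i' by rewrite -nthps.
  move=> <-; rewrite radicand_gt0 /=.
  have i'i : i' != i by rewrite -val_eqE /= neq_ltn ltlj.
  have := logn_subprod_le1 (pdiv (D i)) (fun x => (x == i) || (x == i')).
  rewrite (bigD1 i) ?eqxx //= (big_pred1 i') => [|x]; last first.
    by rewrite /= andbC; case: (eqVneq x i) => [->|] //=; rewrite eq_sym (negPf i'i).
  by rewrite lognM ?radicand_gt0 // logi ltnS leqn0 => /eqP->.
exists nu => i; have := Dnu i; rewrite szps nthps => /(_ (ltn_ord i)) ->.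
by rewrite /eps valK.
Qed.

Lemma sqr_monomial S : b S ^+ 2 = (\prod_(i in S) D i)%N%:R.
Proof.
by rewrite /b -prodrXl natr_prod; apply: eq_bigr => i _; rewrite sqrtCK.
Qed.

Lemma monomial_neq0 S : b S != 0.
Proof. by rewrite -sqrf_eq0 sqr_monomial pnatr_eq0 -lt0n prod_D_gt0. Qed.

Lemma monomial0 : b set0 = 1.
Proof. by rewrite /b big_set0. Qed.

Lemma monomial1 i : b [set i] = r i.
Proof. by rewrite /b big_set1. Qed.

Lemma monomial_real S : b S \is Num.real.
Proof.
rewrite /b; apply: rpred_prod => i _.
by rewrite ger0_real // sqrtC_ge0 ler0n.
Qed.

Lemma monomial_Aint S : b S \in Aint.
Proof.
rewrite /b; apply: rpred_prod => i _.
apply: (@root_monic_Aint ('X^2 - (D i)%:R%:P)).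
- by rewrite /root !hornerE sqrtCK subrr.
- exact: monicXnsubC.
- by apply/polyOverP => j; rewrite coefB coefXn coefC; case: ifP => _; rewrite rpredB ?rpred_nat ?rpred0.
Qed.

Lemma monomial_mqfield S : K (b S).
Proof.
apply: subfield_prod => [|i _]; first exact: mqfield_subfield.
by apply: mqfield_sqrtC; rewrite map_f ?mem_enum.
Qed.

Lemma mul_monomial S T :
  b S * b T = (\prod_(i in S :&: T) D i)%N%:R * b ((S :\: T) :|: (T :\: S)).
Proof.
rewrite /b -(sqr_monomial (S :&: T)) /b.
rewrite !(big_mkcond (fun i => i \in _)) -prodrXl -!big_split /=.
apply: eq_bigr => i _; rewrite !inE.
by case: (i \in S); case: (i \in T); rewrite ?mul1r ?mulr1 ?expr1n ?mul1r -?expr2.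
Qed.

Lemma sqr_sign_char A S : chi A S ^+ 2 = 1.
Proof. by rewrite /chi -prodrXl big1 // => i _; rewrite sqrr_sign. Qed.

Lemma sign_char_orthogonal S T :
  \sum_A chi A S * chi A T = if S == T then (2 ^ k)%N%:R else 0.
Proof.
case: eqVneq => [<-|neST].
  under eq_bigr do rewrite -expr2 sqr_sign_char.
  by rewrite sumr_const cardT -cardE card_set_ord.
have [j jST] : exists j, (j \in S) (+) (j \in T).
  apply/existsP; apply: contraNT neST; rewrite negb_exists => /forallP eqST.
  by apply/eqP/setP => i; have := eqST i; rewrite negb_add => /eqP.
(* Toggling the membership of j in A changes the sign of every summand. *)
pose h (A : {set 'I_k}) := [set i | (i \in A) (+) (i == j)].
have hK : involutive h by move=> A; apply/setP => i; rewrite !inE addbK.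
have chi_h A U : chi (h A) U = (-1) ^+ (j \in U) * chi A U.
  rewrite /chi.
  under eq_bigr do rewrite inE signr_addb.
  rewrite big_split /= mulrC; congr (_ * _).
  have [jU|jU] := boolP (j \in U); last first.
    by rewrite big1 // => i iU; case: eqVneq iU jU => // -> ->.
  rewrite (bigD1 j) //= eqxx big1 ?mulr1 // => i /andP[_ /negPf->] //.
suff : \sum_A chi A S * chi A T = - \sum_A chi A S * chi A T.
  by move/eqP; rewrite -addr_eq0 -mulr2n mulrn_eq0 /= => /eqP.
rewrite {1}(reindex_inj (inv_inj hK)) /= -sumrN; apply: eq_bigr => A _.
by rewrite !chi_h mulrACA -signr_addb jST expr1 mulN1r.
Qed.

(** The span of the monomials is a ring by [mul_monomial], and a field because it consists of
    algebraic numbers; so it contains the field generated by the roots. *)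
Lemma mqfield_coordP x :
  K x <-> exists c : {set 'I_k} -> rat, x = \sum_S ratr (c S) * b S.
Proof.
have fK := mqfield_subfield ps; split=> [Kx|[c ->]]; last first.
  apply: (subfield_sum _ fK) => S _; apply: (subfieldM _ fK); first exact: subfield_rat.
  exact: monomial_mqfield.
pose V x := exists c : {set 'I_k} -> rat, x = \sum_S ratr (c S) * b S.
have VD y z : V y -> V z -> V (y + z).
  move=> [c ->] [d ->]; exists (fun S => c S + d S).
  by rewrite -big_split; apply: eq_bigr => S _; rewrite rmorphD mulrDl.
have Vsum (I : finType) (F : I -> algC) : (forall i, V (F i)) -> V (\sum_i F i).
  move=> VF; apply: (big_ind V) => //; exists (fun=> 0).
  by rewrite big1 // => S _; rewrite rmorph0 mul0r.
have Vb q S : V (ratr q * b S).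
  exists (fun T => if T == S then q else 0).
  rewrite (bigD1 S) //= eqxx big1 ?addr0 // => T /negPf->.
  by rewrite rmorph0 mul0r.
have Vq q : V (ratr q) by rewrite -[ratr q]mulr1 -monomial0.
have VM y z : V y -> V z -> V (y * z).
  move=> [c ->] [d ->]; rewrite mulr_suml; apply: (Vsum) => S.
  rewrite mulr_sumr; apply: (Vsum) => T.
  rewrite mulrACA mul_monomial -(ratr_nat algC) mulrA -!rmorphM; exact: Vb.
apply: (Kx V) => [|p /mapP[i _ ->]].
  split=> [|||//|y Vy _].
  - by have := Vq 0; rewrite rmorph0.
  - by have := Vq 1; rewrite rmorph1.
  - move=> y z Vy Vz; apply: VD => //; rewrite -mulN1r.
    by apply: VM => //; have := Vq (-1); rewrite rmorphN1.
  - exact: (rat_subalgebra_invr V).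
by have := Vb 1 [set i]; rewrite rmorph1 mul1r monomial1.
Qed.

(** * Coordinates recovered from twisted traces: degree and integrality *)

Variable nu : {set 'I_k} -> {rmorphism algC -> algC}.
Hypothesis nu_r : forall A i, nu A (r i) = (-1) ^+ (i \in A) * r i.

Lemma nu_monomial A S : nu A (b S) = chi A S * b S.
Proof. by rewrite /b rmorph_prod -big_split; apply: eq_bigr => i _; apply: nu_r. Qed.

(** Fourier inversion: orthogonality leaves only the coordinate at [S]. Coordinates are only assumed
    fixed by the automorphisms, so rational and integer ones are both covered. *)
Lemma twisted_trace (c : {set 'I_k} -> algC) x S :
  (forall A T, nu A (c T) = c T) -> x = \sum_T c T * b T ->
  \sum_A chi A S * nu A x = (2 ^ k)%N%:R * (c S * b S).
Proof.
move=> nuc ->.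
transitivity (\sum_A \sum_T c T * b T * (chi A T * chi A S)).
  apply: eq_bigr => A _; rewrite rmorph_sum mulr_sumr; apply: eq_bigr => T _.
  by rewrite rmorphM /= nuc nu_monomial; ring.
rewrite exchange_big (bigD1 S) //= -mulr_sumr sign_char_orthogonal eqxx big1 ?addr0.
  by rewrite mulrC.
by move=> T /negPf neTS; rewrite -mulr_sumr sign_char_orthogonal neTS mulr0.
Qed.

Lemma mqfield_degree : field_degree K (2 ^ k).
Proof.
rewrite -card_set_ord; exists (fun i => b (enum_val i)); split.
  by move=> i; apply: monomial_mqfield.
have sumE (c : 'rV[rat]_#|{: {set 'I_k}}|) :
    \sum_i ratr (c 0 i) * b (enum_val i) = \sum_S ratr (c 0 (enum_rank S)) * b S.
  rewrite [RHS](reindex (@enum_val _ predT)) /=; last first.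
    exact/onW_bij/enum_val_bij.
  by apply: eq_bigr => i _; rewrite enum_valK.
move=> x /mqfield_coordP[c Dx]; exists (\row_i c (enum_val i)); split.
  by rewrite sumE Dx; apply: eq_bigr => S _; rewrite mxE enum_rankK.
move=> d Dx'; apply/rowP => i; rewrite mxE; set S := enum_val i.
rewrite sumE in Dx'.
have fixed (e : {set 'I_k} -> rat) A T : nu A (ratr (e T)) = ratr (e T) by rewrite fmorph_rat.
(* Uniqueness: the twisted trace of [x] determines its coordinate at [S]. *)
have := twisted_trace _ _ S (fixed (fun T => d 0 (enum_rank T))) Dx'.
rewrite (twisted_trace _ _ S (fixed c) Dx) enum_valK => eqS.
apply: (fmorph_inj (ratr : rat -> algC)); apply: (mulIf (monomial_neq0 S)).
by apply: (mulfI _ eqS); rewrite pnatr_eq0 expn_eq0.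
Qed.

(** The twisted trace [q S * b S] is an algebraic integer, and its square [q S ^+ 2] times a
    squarefree number is rational, hence an integer. So [q S] itself is an integer. *)
Lemma OK_coord x : OK K x ->
  exists z : {set 'I_k} -> int, (2 ^ k)%N%:R * x = \sum_S (z S)%:~R * b S.
Proof.
case=> /mqfield_coordP[c Dx] Ax.
have fixed A T : nu A (ratr (c T)) = ratr (c T) by rewrite fmorph_rat.
pose q S := (2 ^ k)%N%:R * c S.
have q_int S : q S = (numq (q S))%:~R.
  have Aq : ratr (q S) * b S \in Aint.
    have := twisted_trace _ _ S fixed Dx; rewrite mulrA /q rmorphM /= ratr_nat => <-.
    apply: rpred_sum => A _; rewrite rpredM ?Aint_aut //.
    by apply: rpred_prod => i _; rewrite rpredX // rpredN1.
  have := rpredX 2 Aq; rewrite exprMn sqr_monomial => A2.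
  have : (ratr (q S ^+ 2 * (\prod_(i in S) D i)%N%:R) : algC) \in Num.int.
    apply: Cint_rat_Aint; first exact: Crat_rat.
    by rewrite rmorphM rmorphXn /= ratr_nat.
  case/intrP => m; rewrite -ratr_int => /(fmorph_inj _) Dm.
  apply: sqfree_sqr_rat_int Dm; first exact: prod_D_gt0.
  by move=> p; apply: logn_subprod_le1.
exists (fun S => numq (q S)); rewrite Dx mulr_sumr; apply: eq_bigr => S _.
by rewrite mulrA -ratr_int -q_int /q rmorphM /= ratr_nat.
Qed.

Lemma OK_coord_comb (z : {set 'I_k} -> int) : OK K (\sum_S (z S)%:~R * b S).
Proof.
have fK := mqfield_subfield ps; split.
  apply: (subfield_sum _ fK) => S _; apply: (subfieldM _ fK); first exact: subfield_int.
  exact: monomial_mqfield.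
by apply: rpred_sum => S _; rewrite rpredM ?Aint_int // monomial_Aint.
Qed.

Lemma nu_real A x : K x -> nu A x \is Num.real.
Proof.
case/mqfield_coordP => c ->; rewrite rmorph_sum rpred_sum // => S _.
rewrite rmorphM /= nu_monomial fmorph_rat rpredM ?(Creal_Crat (Crat_rat _)) // rpredM ?monomial_real //.
by apply: rpred_prod => i _; rewrite rpredX // rpredN1.
Qed.

Lemma nu_real_embedding A : real_embedding K (nu A).
Proof.
split; last exact: nu_real.
by split=> [x y _ _|x y _ _|]; rewrite ?rmorphD ?rmorphM ?rmorph1.
Qed.


Lemma nu_qform_gt0 n (a : 'I_n -> 'I_n -> algC) x A :
  totally_pos_def K a -> (forall i, K (x i)) -> (exists i, x i != 0) ->
  0 < nu A (qform a x).
Proof.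
move=> pos_a Kx [i x_i]; rewrite qform_rmorphism; apply: (pos_a (nu A)).
- exact: nu_real_embedding.
- by move=> j; apply: nu_real.
- by exists i; rewrite fmorph_eq0.
Qed.

Lemma nu_qform_ge0 n (a : 'I_n -> 'I_n -> algC) x A :
  totally_pos_def K a -> (forall i, K (x i)) -> 0 <= nu A (qform a x).
Proof.
move=> pos_a Kx; have [/existsP nz|] := boolP [exists i, x i != 0].
  exact/ltW/nu_qform_gt0.
rewrite negb_exists => /forallP z; rewrite qform0 ?rmorph0 // => i.
by have := z i; rewrite negbK => /eqP.
Qed.

(** The denominator [2 ^ k] allowed by [OK_coord] cancels the factor [2 ^ k] produced by
    [twisted_trace]. *)
Lemma OK_twisted_trace x : OK K x ->
  exists z : {set 'I_k} -> int,
    forall S, \sum_A chi A S * nu A x = (z S)%:~R * b S.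
Proof.
move=> /OK_coord[z Dz]; exists z => S.
have k0 : (2 ^ k)%N%:R != 0 :> algC by rewrite pnatr_eq0 expn_eq0.
apply: (mulfI k0); rewrite -(twisted_trace (fun S => (z S)%:~R) _ S _ Dz).
  by rewrite mulr_sumr; apply: eq_bigr => A _; rewrite rmorphM rmorph_nat mulrCA.
by move=> A T; rewrite rmorph_int.
Qed.

(** * The Pell relation, the weight [w] and the elements [alpha t] *)

Variables (i0 : 'I_k) (m f : nat).
Hypothesis pell : (m ^ 2 + 1 = f ^ 2 * D i0)%N.
Let r0 := r i0.
Let w : algC := f%:R - m%:R / r0.

Lemma sqrt_radicand_gt0 i : 0 < r i.
Proof. by rewrite sqrtC_gt0 ltr0n radicand_gt0. Qed.

Lemma pellC : m%:R ^+ 2 + 1 = (f%:R * r0) ^+ 2.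
Proof. by rewrite exprMn sqrtCK -!natrX -natrM -pell natrD. Qed.

Lemma pell_lt : m%:R < f%:R * r0.
Proof.
have r_ge0 : 0 <= r0 := ltW (sqrt_radicand_gt0 i0).
rewrite -(@ltr_pXn2r _ 2) ?nnegrE ?mulr_ge0 ?ler0n //.
by rewrite -pellC ltrDl ltr01.
Qed.

Lemma pell_f_gt0 : (0 < f)%N.
Proof. by case: (f) pell => //; rewrite addn1. Qed.

Lemma nu_w A : nu A w = f%:R - m%:R / r0 * (-1) ^+ (i0 \in A).
Proof.
rewrite rmorphB rmorphM fmorphV !rmorph_nat nu_r -/r0.
by case: (_ \in _); rewrite ?(mulN1r, invrN, mulrN1, mulrN, mul1r, mulr1).
Qed.

Lemma nu_w_gt0 A : 0 < nu A w.
Proof.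
rewrite nu_w; have quot : m%:R / r0 < f%:R by rewrite ltr_pdivrMr ?sqrt_radicand_gt0 ?pell_lt.
case: (_ \in _); rewrite ?expr1 ?expr0 ?mulrN1 ?opprK ?mulr1; last by rewrite subr_gt0.
by rewrite ltr_wpDr ?ltr0n ?pell_f_gt0 // divr_ge0 ?ler0n // ltW ?sqrt_radicand_gt0.
Qed.

(** The trace is [f] times that of [x] minus [m] times that of [x / r0]. The latter is an integer
    because the trace of [x] twisted by [[set i0]] is an integer multiple of [r0]. *)
Lemma trace_w_int x : OK K x -> \sum_A nu A (w * x) \in Num.int.
Proof.
move=> /OK_twisted_trace[z Dz].
have -> : \sum_A nu A (w * x) = f%:R * (z set0)%:~R - m%:R * (z [set i0])%:~R.
  have := Dz [set i0]; have := Dz set0; rewrite monomial0 monomial1 mulr1 => <- D0.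
  have -> : (z [set i0])%:~R = r0^-1 * ((z [set i0])%:~R * r i0).
    by rewrite mulrCA mulVf ?mulr1 // gt_eqF ?sqrt_radicand_gt0.
  rewrite -D0 !mulr_sumr -sumrB; apply: eq_bigr => A _.
  rewrite rmorphM nu_w /chi big_set0 big_set1; ring.
by rewrite rpredB ?rpredM ?rpred_nat ?intr_int.
Qed.

Lemma trace_w_ge1 x : OK K x -> (forall A, 0 < nu A x) ->
  1 <= \sum_A nu A (w * x).
Proof.
move=> Kx x_gt0.
have : 0 < \sum_A nu A (w * x).
  rewrite (bigD1 set0) //=; apply: ltr_wpDr; last by rewrite rmorphM mulr_gt0 ?nu_w_gt0.
  by apply: sumr_ge0 => A _; rewrite rmorphM mulr_ge0 // ltW ?nu_w_gt0.
have /intrP[z ->] := trace_w_int _ Kx.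
by rewrite ltr0z ler1z gtz0_ge1.
Qed.

(** By [pell] the first factor is a unit of norm -1 in the quadratic field of [r0]. When [r0]
    changes sign it becomes negative, as does [r0 + t] for [t < r0], so the product stays
    positive. *)
Let alpha (t : nat) : algC := (m%:R + f%:R * r0) * (r0 + t%:R).

Lemma alpha_OK t : OK K (alpha t).
Proof.
have fK := mqfield_subfield ps.
have Kr : OK K r0 by rewrite -[r0]monomial1; split; [apply: monomial_mqfield | apply: monomial_Aint].
apply: (OKM _ fK); apply: (OKD _ fK) => //; try exact: (OK_nat _ fK).
by apply: (OKM _ fK) => //; exact: (OK_nat _ fK).
Qed.

Lemma alpha_totally_positive t : t%:R < r0 -> totally_positive K (alpha t).
Proof.
move=> lt_tr s [es _]; have fK := mqfield_subfield ps.
have Kr : K r0 by rewrite -[r0]monomial1; apply: monomial_mqfield.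
have Kn := subfield_nat _ fK.
rewrite (embeddingM _ _ es) ?(embeddingD _ _ es) ?(embeddingM _ _ es) ?(embedding_nat _ fK _ es) //;
  try by do ?[exact: Kn | apply: (subfieldD _ fK) | apply: (subfieldM _ fK)].
have m_ge0 : 0 <= m%:R :> algC by rewrite ler0n.
have fr := pell_lt; have r0_gt0 := sqrt_radicand_gt0 i0; rewrite -/r0 in r0_gt0.
have ps_i0 : D i0 \in ps by rewrite map_f ?mem_enum.
case: (embedding_sqrtC _ _ _ es ps_i0) => ->; rewrite -/(r i0) -/r0.
  apply: mulr_gt0; last by rewrite ltr_wpDr ?ler0n.
  by rewrite ltr_wpDl // mulr_gt0 // ltr0n pell_f_gt0.
by rewrite mulrN nmulr_rgt0 ?subr_lt0 // addrC subr_lt0.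
Qed.

Lemma alpha_inj t t' : alpha t = alpha t' -> t = t'.
Proof.
have nz : m%:R + f%:R * r0 != 0.
  by apply: lt0r_neq0; rewrite ltr_wpDl ?ler0n // mulr_gt0 ?sqrt_radicand_gt0 // ltr0n pell_f_gt0.
by move/(mulfI nz)/addrI/eqP; rewrite eqr_nat => /eqP.
Qed.

(** By [pellC], [w] times the unit [m + f * r0] is [1 / r0]; the trace of [t / r0] vanishes since
    both signs of [r0] occur equally often. *)
Lemma trace_w_alpha t : \sum_A nu A (w * alpha t) = (2 ^ k)%N%:R.
Proof.
have r0n : r0 != 0 by rewrite gt_eqF ?sqrt_radicand_gt0.
have -> : w * alpha t = 1 + t%:R / r0.
  rewrite /w /alpha; apply: (mulIf r0n).
  have -> : (f%:R - m%:R / r0) * ((m%:R + f%:R * r0) * (r0 + t%:R)) * r0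
     = ((f%:R * r0) ^+ 2 - m%:R ^+ 2) * (r0 + t%:R) by field.
  by rewrite -pellC addrC addKr mul1r mulrDl mul1r divfK.
have neq0 : set0 != [set i0] by rewrite eq_sym -card_gt0 cards1.
have chi0 : \sum_A chi A [set i0] = 0.
  have := sign_char_orthogonal set0 [set i0]; rewrite (negPf neq0) => sum0.
  rewrite -[RHS]sum0.
  by apply: eq_bigr => A _; rewrite /chi big_set0 mul1r.
have nuE A : nu A (1 + t%:R / r0) = 1 + t%:R / r0 * chi A [set i0].
  rewrite rmorphD rmorph1 rmorphM fmorphV rmorph_nat nu_r /chi big_set1 -/r0.
  by case: (_ \in _); rewrite ?(mulN1r, invrN, mulrN1, mulrN, mul1r, mulr1).
under eq_bigr do rewrite nuE.
rewrite big_split /= -mulr_sumr chi0 mulr0 addr0 sumr_const cardT -cardE.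
by rewrite card_set_ord.
Qed.

(** * The lower bound on the number of variables, by pigeonhole *)

(** [R] bounds the number of residue vectors, and [R ^ 2 < D i0] leaves [R + 1] admissible values of
    [t]. *)
Lemma multiquadratic_m_ge N R :
  (R ^ 2 < D i0)%N -> ((2 ^ k * 2 ^ (k + 2)) ^ (N * 2 ^ k) <= R)%N -> m_ge K N.
Proof.
(* The integer coordinates belong to [2 ^ k] times a vector, so a congruence modulo [Mo] between
   vectors comes from one modulo [Q] between coordinates. *)
set Mo := (2 ^ (k + 2))%N; set Q := (2 ^ k * Mo)%N => ltRD leQR n a aK pos_a univ.
rewrite leqNgt; apply/negP => lt_nN.
have fK := mqfield_subfield ps.
have Mo_gt0 : (0 < Mo)%N by rewrite expn_gt0.
have Q_gt0 : (0 < Q)%N by rewrite muln_gt0 expn_gt0.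
have lt_r0 (t : 'I_R.+1) : (t : nat)%:R < r0.
  have r_ge0 : 0 <= r0 := ltW (sqrt_radicand_gt0 i0).
  rewrite -(@ltr_pXn2r _ 2) ?nnegrE ?ler0n // sqrtCK -natrX ltr_nat.
  by apply: leq_ltn_trans ltRD; rewrite leq_exp2r // -ltnS.
pose rep_of (t : 'I_R.+1) (vz : ('I_n -> algC) * ('I_n -> {set 'I_k} -> int)) :=
  [/\ forall i, OK K (vz.1 i), qform a vz.1 = alpha t &
      forall i, (2 ^ k)%N%:R * vz.1 i = \sum_S (vz.2 i S)%:~R * b S].
have ex_rep t : exists vz, rep_of t vz.
  have [v [Kv Dv]] := univ _ (alpha_OK t) (alpha_totally_positive t (lt_r0 t)).
  have [z Dz] := fin_all_exists (fun i => OK_coord (v i) (Kv i)).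
  by exists (v, z).
have [vz rep_vz] := fin_all_exists ex_rep.
pose v t := (vz t).1; pose z t := (vz t).2.
(* There are at most [R] residue vectors for [R + 1] values of [t]. The type ['I_Q.-1.+1] is the
   residues modulo [Q] in the successor form that [inord] expects. *)
pose g (t : 'I_R.+1) : {ffun 'I_n * {set 'I_k} -> 'I_Q.-1.+1} :=
  [ffun iS => inord `|(z t iS.1 iS.2 %% Q)%Z|%N].
have /injectivePn [t [t' ne_tt' eq_g]] : ~~ injectiveb g.
  apply/negP => /injectiveP/leq_card.
  rewrite card_ord card_ffun card_prod !card_ord card_set_ord prednK // leqNgt ltnS.
  by rewrite (leq_trans _ leQR) // leq_pexp2l // leq_mul2r ltnW ?orbT.
have dvdQ i S : (Q %| z t i S - z t' i S)%Z.
  have := congr1 (fun h : {ffun _ -> _} => val (h (i, S))) eq_g.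
  have modK x : (`|(x %% Q)%Z| < Q.-1.+1)%N.
    by rewrite prednK // -ltz_nat gez0_abs ?modz_ge0 ?ltz_pmod ?gt_eqF.
  rewrite !ffunE /= !inordK ?modK // => /(congr1 Posz).
  rewrite !gez0_abs ?modz_ge0 ?gt_eqF // => /eqP.
  by rewrite eqz_mod_dvd.
pose y i S := ((z t i S - z t' i S) %/ Q)%Z.
(* An integer combination of the monomials, hence integral. *)
pose u i := \sum_S (y i S)%:~R * b S.
have Ku i : OK K (u i) by apply: OK_coord_comb.
have [Kv Dv Dz] := rep_vz t; have [Kv' Dv' Dz'] := rep_vz t'.
have k0 : (2 ^ k)%N%:R != 0 :> algC by rewrite pnatr_eq0 expn_eq0.
have Du i : Mo%:R * u i = v t i - v t' i.
  apply: (mulfI k0); rewrite mulrBr Dz Dz' -sumrB mulrA -natrM -/Q mulr_sumr.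
  apply: eq_bigr => S _; rewrite mulrA -mulrBl -rmorphB /=; congr (_ * _).
  by rewrite -[X in _ = X%:~R](divzK (dvdQ i S)) mulrC intrM.
have u_nz : exists i, u i != 0.
  apply/existsP; apply: contraNT ne_tt'; rewrite negb_exists => /forallP u0.
  apply/eqP/val_inj/alpha_inj; rewrite -Dv -Dv'; apply: eq_qform => i.
  apply/eqP; rewrite -subr_eq0 -Du.
  by have := u0 i; rewrite negbK => /eqP->; rewrite mulr0.
have qu_gt0 A : 0 < nu A (qform a u) by apply: nu_qform_gt0 => // i; case: (Ku i).
have tr_ge1 := trace_w_ge1 _ (OK_qform _ fK _ _ _ aK Ku) qu_gt0.
have par := qform_parallelogram _ a (v t) (v t').
rewrite Dv Dv' -(eq_qform _ _ _ _ Du) qformZ in par.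
have : Mo%:R ^+ 2 * \sum_A nu A (w * qform a u) <= (Mo%:R : algC).
  (* This fixes the choice of [Mo]: twice the sum of two traces [2 ^ k] is [2 ^ (k + 2)]. *)
  have MoE : Mo%:R = \sum_A nu A (w * (2%:R * (alpha t + alpha t'))) :> algC.
    transitivity (2%:R * (\sum_A nu A (w * alpha t) + \sum_A nu A (w * alpha t'))).
      rewrite !trace_w_alpha -natrD -natrM /Mo expnD; congr _%:R.
      by rewrite addnn -mul2n mulnA mulnC.
    rewrite -big_split mulr_sumr; apply: eq_bigr => A _ /=.
    by rewrite !(rmorphM, rmorphD) rmorph1; ring.
  (* The difference of the two sides is the contribution of [v t + v t'], which is nonnegative under
     every [nu A]. *)
  rewrite [leRHS]MoE mulr_sumr; apply: ler_sum => A _.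
  rewrite -par mulrDr rmorphD -[leLHS]add0r.
  have -> : Mo%:R ^+ 2 * nu A (w * qform a u) = nu A (w * (Mo%:R ^+ 2 * qform a u)).
    by rewrite [w * (_ * _)]mulrCA [RHS]rmorphM rmorphXn rmorph_nat.
  rewrite lerD2r rmorphM mulr_ge0 ?(ltW (nu_w_gt0 _)) //.
  apply: nu_qform_ge0 => // i; apply: (subfieldD _ fK); [case: (Kv i) | case: (Kv' i)]; done.
(* The order on [algC] is partial, so negating the inequality needs both sides real. *)
apply/negP; rewrite -real_ltNge ?realn //; last first.
  by rewrite rpredM ?rpredX ?realn // ger0_real // (le_trans ler01 tr_ge1).
apply: (@lt_le_trans _ _ (Mo%:R ^+ 2)).
  by rewrite -natrX ltr_nat -[X in (X < _)%N]expn1 ltn_exp2l // /Mo addn2 expnS leq_pmulr ?expn_gt0.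
by rewrite ler_peMr // -natrX ler0n.
Qed.

End Multiquadratic.

(** * Choosing the radicands, and infinitely many fields *)

Lemma prime_exactly_dividing_sqr_add1 (B : nat) :
  exists p m, [/\ prime p, (B < p)%N & logn p (m ^ 2 + 1) = 1%N].
Proof.
(* The shift by 2 makes [p] odd, so that [p] does not divide [2 * c]. *)
set c := (B.+2)`!; pose p := pdiv (c ^ 2 + 1).
have c_gt0 : (0 < c)%N by rewrite fact_gt0.
have p_pr : prime p by rewrite pdiv_prime // addn1 ltnS expn_gt0 c_gt0.
have p_dvd : (p %| c ^ 2 + 1)%N by apply: pdiv_dvd.
have p_ndvd_c : ~~ (p %| c)%N.
  apply: contraL p_dvd => pc; rewrite dvdn_addr ?dvdn1; last by rewrite dvdn_exp.
  by rewrite neq_ltn prime_gt1 ?orbT.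
have ltBp : (B.+2 < p)%N.
  by rewrite ltnNge; apply: contra p_ndvd_c => le_pB; rewrite dvdn_fact // prime_gt0.
have lognE n : (0 < n)%N -> (p %| n)%N -> ~~ (p ^ 2 %| n)%N -> logn p n = 1%N.
  move=> n0 pn p2n; apply/eqP; rewrite eqn_leq logn_gt0 mem_primes p_pr n0 pn !andbT.
  by rewrite leqNgt -pfactor_dvdn.
exists p; have ltB : (B < p)%N by lia.
(* At most one of c^2 + 1 and (c + p)^2 + 1 is divisible by p^2, since p does not divide 2c. *)
have [p2|p2] := boolP (p ^ 2 %| c ^ 2 + 1)%N; last by exists c; split=> //; apply: lognE => //; lia.
exists (c + p)%N; split=> //.
have E : ((c + p) ^ 2 + 1 = (c ^ 2 + 1 + p ^ 2) + p * (2 * c))%N by lia.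
apply: lognE; rewrite ?E; first lia.
  by rewrite dvdn_addr ?dvdn_mulr // dvdn_add // dvdn_exp.
rewrite dvdn_addr; last by rewrite dvdn_add.
rewrite expnS expn1 dvdn_pmul2l ?prime_gt0 // Euclid_dvdM // (negPf p_ndvd_c) orbF.
by rewrite gtnNdvd //; lia.
Qed.

(** Take [f] maximal with [f ^ 2] dividing [n]: a square [q ^ 2] dividing the cofactor would allow
    [f * q]. *)
Lemma sqfree_decomposition (n : nat) :
  (0 < n)%N -> exists f d, (n = f ^ 2 * d)%N /\ forall q, (logn q d <= 1)%N.
Proof.
move=> n_gt0; pose P f := (f ^ 2 %| n)%N.
have exP : exists f, P f by exists 1%N; rewrite /P exp1n dvd1n.
have ubP f : P f -> (f <= n)%N.
  move=> /dvdn_leq-/(_ n_gt0); apply: leq_trans; case: f => // f.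
  by rewrite -[X in (X <= _)%N]expn1 leq_pexp2l.
case: (ex_maxnP exP ubP) => f /dvdnP[d Dn] maxf; exists f, d; split; first by rewrite mulnC.
move=> q; rewrite leqNgt; apply/negP => lt1q.
have q_pr : prime q by apply: contraLR lt1q => /negPf npr; rewrite lognE npr.
have d_gt0 : (0 < d)%N by case: (d) Dn n_gt0 => // ->.
have f_gt0 : (0 < f)%N by case: (f) Dn n_gt0 => // ->; rewrite muln0.
rewrite -pfactor_dvdn // in lt1q.
have := maxf (f * q)%N; rewrite /P Dn expnMn mulnC dvdn_mul // => /(_ isT).
by rewrite leqNgt ltn_Pmulr ?prime_gt1.
Qed.

(** Each new entry is a prime exceeding the product so far. *)
Lemma extend_sqfree (n j : nat) : (0 < n)%N -> (forall q, (logn q n <= 1)%N) ->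
  exists qs : seq nat, [/\ size qs = j, {in qs, forall q, (1 < q)%N} &
    forall q, (logn q (n * \prod_(x <- qs) x) <= 1)%N].
Proof.
move=> n_gt0 sqf; elim: j => [|j [qs [szqs qs1 sqfqs]]].
  by exists [::]; split=> // q; rewrite big_nil muln1.
set m := (n * _)%N in sqfqs.
have m_gt0 : (0 < m)%N.
  by rewrite muln_gt0 n_gt0 big_seq prodn_cond_gt0 // => q /qs1/ltnW.
have [l ltml l_pr] := prime_above m; exists (l :: qs); split; first by rewrite /= szqs.
  by move=> q; rewrite inE => /orP[/eqP->|/qs1] //; apply: prime_gt1.
move=> q; rewrite big_cons mulnCA lognM ?(prime_gt0 l_pr) // logn_prime //.
case: eqVneq => [->|_]; last exact: sqfqs.
by rewrite add1n ltnS leqn0 lognE gtnNdvd ?andbF ?if_same.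
Qed.

(** Used to avoid the given [L i]: a prime above [B] divides none of the chosen radicands. Whether
    [L i] is multiquadratic is decided classically. *)
Lemma radicand_bound (M : nat) (L : nat -> algC -> Prop) :
  exists B, forall i, (i < M)%N ->
    (exists2 qs : seq nat, {in qs, forall q, (0 < q)%N} & forall x, mqfield qs x <-> L i x) ->
    exists2 qs : seq nat, {in qs, forall q, 0 < q <= B}%N & forall x, mqfield qs x <-> L i x.
Proof.
elim: M => [|M [B IH]]; first by exists 0%N.
have [[qs qs0 Lqs]|noqs] := classic (exists2 qs : seq nat, {in qs, forall q, (0 < q)%N} &
    forall x, mqfield qs x <-> L M x); last first.
  exists B => i; rewrite ltnS leq_eqVlt => /orP[/eqP-> /noqs//|]; exact: IH.
exists (maxn B (\max_(q <- qs) q)%N) => i; rewrite ltnS leq_eqVlt => /orP[/eqP-> _|ltiM].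
  exists qs => // q qsq; rewrite qs0 //= leq_max; apply/orP; right.
  exact: (@leq_bigmax_seq _ qs predT id q qsq isT).
move=> /(IH i ltiM)[rs rsB Lrs]; exists rs => // q /rsB/andP[-> /= le_qB].
by rewrite leq_max le_qB.
Qed.

(* "infinitely many": for any finitely many subsets L_0..L_{M-1} of algC there is
   such a field different from all of them. *)
Theorem theorem1 (k N : nat) (hk : (0 < k)%N) (hN : (0 < N)%N)
    (M : nat) (L : nat -> algC -> Prop) :
  exists ps : seq nat,
    size ps = k /\
    (forall p, p \in ps -> (0 < p)%N) /\
    totally_real (mqfield ps) /\
    field_degree (mqfield ps) (2 ^ k) /\
    m_ge (mqfield ps) N /\
    (forall i, (i < M)%N -> ~ (forall x, mqfield ps x <-> L i x)).
Proof.
have [B boundL] := radicand_bound M L.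
pose R := ((2 ^ k * 2 ^ (k + 2)) ^ (N * 2 ^ k))%N.
(* [p] above [B] makes the field new, and [p] above [R ^ 2] makes the radicand large enough for the
   pigeonhole. *)
have [p [m [p_pr ltp logp]]] := prime_exactly_dividing_sqr_add1 (maxn B (R ^ 2)).
move: ltp; rewrite gtn_max => /andP[ltBp ltRp].
have [|f [d [Dm sqfd]]] := sqfree_decomposition (m ^ 2 + 1); first by rewrite addn1.
have d_gt0 : (0 < d)%N by case: (d) Dm => //; rewrite muln0 addn1.
have f_gt0 : (0 < f)%N by case: (f) Dm => //; rewrite addn1.
(* The valuation 1 of [m ^ 2 + 1] is twice that of [f] plus that of [d], so [p] survives in the
   squarefree part. *)
have odd_d : odd (logn p d).
  have := congr1 odd logp; rewrite Dm lognM ?expn_gt0 ?f_gt0 // lognX oddD oddM.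
  by [].
have p_dvd_d : (p %| d)%N.
  by have := odd_gt0 odd_d; rewrite logn_gt0 mem_primes => /and3P[].
have le_pd : (p <= d)%N by apply: dvdn_leq.
(* The other [k.-1] radicands serve to raise the degree to [2 ^ k]. *)
have [qs [szqs qs1 sqfqs]] := extend_sqfree d k.-1 d_gt0 sqfd.
pose ps := d :: qs.
have szps : size ps = k by rewrite /= szqs prednK.
have ps1 : {in ps, forall q, (1 < q)%N}.
  move=> q; rewrite inE => /orP[/eqP->|/qs1] //.
  exact: leq_trans (prime_gt1 p_pr) le_pd.
pose D (i : 'I_k) := nth 0%N ps i.
have DE : [seq D i | i <- enum 'I_k] = ps.
  apply: (@eq_from_nth _ 0%N); rewrite size_map size_enum_ord // => i ltik.
  by rewrite (nth_map (Ordinal ltik)) ?size_enum_ord // /D nth_enum_ord.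
have D1 i : (1 < D i)%N by rewrite ps1 // mem_nth // szps.
have sqfD q : (logn q (\prod_i D i) <= 1)%N.
  have -> : (\prod_i D i = \prod_(x <- ps) x)%N.
    by rewrite -[in RHS]DE big_map big_enum.
  by rewrite big_cons; apply: sqfqs.
have [nu nu_r] := exists_sign_automorphism k D D1 sqfD.
pose i0 := Ordinal hk.
exists ps; split=> //; split; first by move=> q /ps1/ltnW.
split; first exact: mqfield_totally_real.
split; first by rewrite -DE; apply: mqfield_degree nu_r.
split.
  rewrite -DE; apply: (multiquadratic_m_ge k D D1 sqfD nu nu_r i0 m f Dm N R) => //.
  exact: leq_trans ltRp le_pd.
move=> i ltiM Li; have [|rs rsB Lrs] := boundL i ltiM.
  by exists ps => // q /ps1/ltnW.
(* If the field were [L i], this root would lie in a field whose radicands are all prime to [p]. *)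
have : mqfield rs (sqrtC d%:R).
  by apply/Lrs/Li; apply: mqfield_sqrtC; rewrite mem_head.
apply: (sqrtC_notin_mqfield rs d p odd_d) => q /rsB/andP[q0 leqB].
by rewrite q0 lognE gtnNdvd ?andbF ?if_same //; apply: leq_ltn_trans leqB ltBp.
Qed.
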